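(* For every $n\ge1$, \[I_n(-1,t)=\sum_{w\in\mathrm{Simsun}(n-1)}t^{\,n-1-\mathrm{des}(w)}.\]
   Context: $\mathrm{Tree}(n+1)$ is the set of trees on vertex set $\{0,1,\dots,n\}$ rooted at $0$. An inversion of $T$ is a pair $(i,j)$ with $1\le i<j\le n$ such that $j$ lies on the path from $i$ to the root; $\mathrm{inv}(T)$ is the number of inversions. $\mathrm{lev}(T)$ is the number of leaves of $T$ (non-root vertices with no children). $I_n(q,t)=\sum_{T\in\mathrm{Tree}(n+1)}q^{\mathrm{inv}(T)}t^{\mathrm{lev}(T)-1}$. A double descent of a word $u_1\cdots u_m$ is an index $i\in\{2,\dots,m-1\}$ with $u_{i-1}>u_i>u_{i+1}$. A permutation $w\in\mathfrak S_m$ (in one-line notation) is simsun if for every $j$ the word obtained from $w$ by deleting all entries greater than $j$ has no double descents; $\mathrm{Simsun}(m)$ is the set of these ($\mathrm{Simsun}(0)$ consists of the empty permutation). $\mathrm{des}(w)=|\{i:w(i)>w(i+1)\}|$. *)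

(* Defs.v *)
From mathcomp Require Import all_boot all_order all_algebra all_fingroup.

Set Implicit Arguments.
Unset Strict Implicit.
Unset Printing Implicit Defensive.

Import GRing.Theory.

(* Graphs on the vertex set {0, ..., n} are given by their edge sets, an edge *)
(* being an unordered pair of distinct vertices.                              *)

Section Trees.

Variable n : nat.
Implicit Types (E : {set {set 'I_n.+1}}) (i j u v : 'I_n.+1).

Definition simple_graph E : bool := [forall e in E, #|e| == 2].

Definition adj E : rel 'I_n.+1 := fun u v => [set u; v] \in E.

Definition connected E : bool := [forall u, forall v, connect (adj E) u v].

(* A cycle visits at least three vertices without repetition, so at most n+1  *)
(* of them: bounding the length keeps the predicate boolean.                  *)
Definition acyclic E : bool :=
  [forall k : 'I_n.+2, (2 < k) ==>
    [forall c : k.-tuple 'I_n.+1, ~~ ucycleb (adj E) c]].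

Definition Tree : {set {set {set 'I_n.+1}}} :=
  [set E | [&& simple_graph E, connected E & acyclic E]].

(* j lies on a path (without repeated vertices) i :: p from i to the root 0;  *)
(* in a tree this path is unique.  Such a p has at most n vertices.           *)
Definition on_path_to_root E i j : bool :=
  [exists k : 'I_n.+1, exists p : k.-tuple 'I_n.+1,
    [&& path (adj E) i p, uniq (i :: p), last i p == ord0 & j \in i :: p]].

Definition inv E : nat :=
  #|[set ij : 'I_n.+1 * 'I_n.+1 |
      [&& 1 <= ij.1, ij.1 < ij.2 & on_path_to_root E ij.1 ij.2]]|.

Definition is_child E u v : bool := adj E u v && on_path_to_root E u v.

Definition lev E : nat :=
  #|[set v : 'I_n.+1 | (v != ord0) && [forall u, ~~ is_child E u v]]|.

(* The outer variable of {poly {poly int}} is q and the inner one is t.       *)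
Definition inv_poly : {poly {poly int}} :=
  (\sum_(E in Tree) 'X^(inv E) * ('X^(lev E - 1))%:P)%R.

End Trees.

(* Positions in words are counted from 0. *)
Definition is_double_descent (u : seq nat) (i : nat) : bool :=
  [&& 0 < i, i.+1 < size u, nth 0 u i.-1 > nth 0 u i & nth 0 u i > nth 0 u i.+1].

Definition has_double_descent (u : seq nat) : bool :=
  has (is_double_descent u) (iota 0 (size u)).

(* One-line notation, with letters 1, ..., m. *)
Definition one_line (m : nat) (w : 'S_m) : seq nat :=
  [seq (w i).+1 | i <- enum 'I_m].

(* For j >= m no letter is deleted, so j <= m covers every j. *)
Definition Simsun (m : nat) : {set 'S_m} :=
  [set w | [forall j : 'I_m.+1,
    ~~ has_double_descent [seq x <- one_line w | x <= j]]].

Definition des (m : nat) (w : 'S_m) : nat :=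
  #|[set i : 'I_m | (i.+1 < m) &&
      (nth 0 (one_line w) i > nth 0 (one_line w) i.+1)]|.

(* Main.v *)
(* Put F_n = t I_n(-1, t), F_0 = 1, and let f(x) = sum_n F_n x^n / n!.  Cutting
   a tree at the child r of 0 lying above a fixed vertex m, the inversions with
   larger entry r contribute (-1)^(number of smaller vertices below r); as the
   rest only depends on the size of the block B of vertices below r, summing
   over r in B gives 1 if |B| is odd and 0 otherwise.  Hence
   f' = f (f_even + t - 1), and 1/f, which is f(-x), satisfies the companion
   equation.  Writing F_n as the value of delta^n y at y = u = 1 for a
   derivation delta (u stands for 1/f), a second derivation eps with
   [eps, delta] = -2 c delta, c = t - 1, turns the quadratic recurrence into
   the linear one
     F_(n+1) = (n + 1) (t - 1) F_n + (2 t - t^2) dF_n/dt       (n >= 1),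
   which is also the recurrence obtained by inserting the largest letter into
   simsun permutations. *)
Require Import Defs.
From mathcomp Require Import all_boot all_order all_algebra all_fingroup.
From mathcomp Require Import mpoly ring zify.

Set Implicit Arguments.
Unset Strict Implicit.
Unset Printing Implicit Defensive.

Import GRing.Theory.

(** * Rooted forests as parent functions *)

Lemma card_sum_nat (T : finType) (P : pred T) : #|[set x | P x]| = \sum_x P x.
Proof.
by rewrite -sum1_card big_mkcond; apply: eq_bigr => x _; rewrite inE; case: (P x).
Qed.

Section ParentFunctions.

Variable n : nat.
Notation V := 'I_n.+1.
Implicit Types (f : {ffun V -> V}) (S B : {set V}).

Lemma fconnect_fixed (T : finType) (f : T -> T) x y :
  f x = x -> fconnect f x y = (x == y).
Proof.
move=> fx; apply/idP/eqP => [/iter_findex <-|->]; last exact: connect0.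
by elim: (findex f x y) => //= k <-.
Qed.

Lemma fconnect_codom (T : finType) (f : T -> T) x y :
  fconnect f x y -> x = y \/ exists z, y = f z.
Proof.
move=> /iter_findex <-; case: (findex f x y) => [|k]; first by left.
by right; exists (iter k f x).
Qed.

(** Induction on the number of iterations of [f] that lead from [v] to the root. It serves as
    induction on depth for every parent function below. *)
Lemma rooted_ind f (Q : V -> Prop) :
  (forall v, fconnect f v ord0) -> Q ord0 ->
  (forall v, v != ord0 -> Q (f v) -> Q v) -> forall v, Q v.
Proof.
move=> f0 Q0 QS v; move/iter_findex: (f0 v).
move: (findex f v ord0) => k; elim: k v => {f0} [v /= ->|k IHk v] //.
rewrite iterSr => /IHk Qfv; clear -QS Q0 Qfv.
by have [->|v0] := eqVneq v ord0; [exact: Q0 | exact: QS].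
Qed.

(* A rooted forest on S, seen as a tree on S and the root 0: f v is the parent *)
(* of v, and f is constantly 0 outside S.                                      *)
Definition parent_fun S f :=
  [forall v, fconnect f v ord0] &&
  [forall v, f v \in if v \in S then ord0 |: S else [set ord0]].

Lemma parent_funP S f :
  reflect [/\ forall v, fconnect f v ord0,
              forall v, v \in S -> f v = ord0 \/ f v \in S
            & forall v, v \notin S -> f v = ord0] (parent_fun S f).
Proof.
apply: (iffP andP) => [[/forallP h1 /forallP h2]|[h1 h2 h3]]; split => //.
- by move=> v vS; move: (h2 v); rewrite vS => /setU1P.
- by move=> v /negPf vS; move: (h2 v); rewrite vS => /set1P.
- by apply/forallP.
- apply/forallP=> v; case: ifPn => vS; last by rewrite h3 // set11.
  by apply/setU1P/h2.
Qed.

Definition inversions f : nat :=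
  #|[set ij : V * V | (ij.1 < ij.2) && fconnect f ij.1 ij.2]|.

Definition leaves S f : nat := #|[set v in S | v \notin codom f]|.

(** A vertex outside [S] is sent at once to 0, which is fixed, so a chain that moves and stays away
    from 0 stays in [S]. *)
Lemma parent_fun_connect S f v j :
  ord0 \notin S -> parent_fun S f -> fconnect f v j -> j != ord0 ->
  v = j \/ v \in S /\ j \in S.
Proof.
move=> S0 /parent_funP[h1 h2 h3] + j0; have f0 := h3 _ S0.
move: v; apply: (rooted_ind h1) => [|v v0 IHv].
  by rewrite (fconnect_fixed _ f0) eq_sym (negPf j0).
rewrite fconnect_eqVf => /orP[/eqP->|fvj]; first by left.
right; have vS : v \in S.
  apply: contraTT fvj => /h3->.
  by rewrite (fconnect_fixed _ f0) eq_sym.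
split=> //; case: (IHv fvj) => [<-|[]//].
by case: (h2 _ vS) => // e; move: fvj; rewrite e (fconnect_fixed _ f0) eq_sym (negPf j0).
Qed.

Lemma parent_fun_neq S f v : ord0 \notin S -> parent_fun S f ->
  v != ord0 -> f v != v.
Proof.
move=> S0 /parent_funP[h1 h2 h3] v0; apply: contraNneq v0 => e.
by move: (h1 v); rewrite (fconnect_fixed _ e).
Qed.

(** * Cutting a forest at a child of the root and gluing it back *)

Definition glue B r (f1 f2 : {ffun V -> V}) : {ffun V -> V} :=
  [ffun v => if v \in B then
               if v == r then ord0 else if f1 v == ord0 then r else f1 v
             else f2 v].

(** [below] and [outside] recover the two pieces that [glue] joins. Deleting [r] makes its children
    roots, that is, gives them the parent 0; vertices not in the piece also get the value 0, as
    [parent_fun] demands. *)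
Definition below B r f : {ffun V -> V} :=
  [ffun v => if (v \in B :\ r) && (f v != r) then f v else ord0].

Definition outside B f : {ffun V -> V} :=
  [ffun v => if v \in B then ord0 else f v].

Definition descendants f r := [set v | fconnect f v r].

Section Split.

Variables (S : {set V}) (r : V) (f : {ffun V -> V}).
Hypotheses (S0 : ord0 \notin S) (fS : parent_fun S f) (rS : r \in S).
Hypothesis (fr : f r = ord0).
Let B := descendants f r.

Let r0 : r != ord0. Proof. by apply: contraNneq S0 => <-. Qed.

Lemma descendants_sub : B \subset S.
Proof.
apply/subsetP => v; rewrite inE => fvr.
by case: (parent_fun_connect S0 fS fvr r0) => [->//|[]].
Qed.

Let B0 : ord0 \notin B.
Proof. by apply: contra S0; apply/subsetP/descendants_sub. Qed.

Lemma in_descendants v : (v \in B) = (v == r) || (f v \in B).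
Proof. by rewrite !inE fconnect_eqVf. Qed.

Lemma reach_below v : fconnect (below B r f) v ord0.
Proof.
case/parent_funP: fS => h1 h2 h3.
move: v; apply: (rooted_ind h1) => [|v v0 IHv]; first exact: connect0.
rewrite fconnect_eqVf ffunE; case: ifP => _; first by rewrite IHv orbT.
by rewrite connect0 orbT.
Qed.

Lemma reach_outside v : fconnect (outside B f) v ord0.
Proof.
case/parent_funP: fS => h1 h2 h3.
move: v; apply: (rooted_ind h1) => [|v v0 IHv]; first exact: connect0.
rewrite fconnect_eqVf ffunE; case: ifP => _; last by rewrite IHv orbT.
by rewrite connect0 orbT.
Qed.

Lemma parent_fun_below : parent_fun (B :\ r) (below B r f).
Proof.
apply/parent_funP; split=> [|v vB|v vB]; first exact: reach_below.
- rewrite ffunE vB /=; case: eqP => fvr /=; [by left|right].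
  case/setD1P: vB => vr; rewrite in_descendants (negPf vr) /= => fvB.
  by rewrite !inE in fvB *; rewrite fvB andbT; apply/eqP.
- by rewrite ffunE (negPf vB).
Qed.

Lemma parent_fun_outside : parent_fun (S :\: B) (outside B f).
Proof.
case/parent_funP: fS => h1 h2 h3.
apply/parent_funP; split=> [|v vB|v vB]; first exact: reach_outside.
- case/setDP: vB => vS vB; rewrite ffunE (negPf vB).
  case: (h2 _ vS) => fv; [by left|right].
  rewrite in_setD fv andbT; apply: contra vB => fvB.
  by rewrite in_descendants fvB orbT.
- rewrite ffunE; case: ifPn => // vB'; apply: h3.
  by apply: contra vB => vS; rewrite in_setD vB' vS.
Qed.

Lemma glue_split : glue B r (below B r f) (outside B f) = f.
Proof.
apply/ffunP => v; rewrite !ffunE; case: ifPn => vB; last by rewrite (negPf vB).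
have [->|vr] := eqVneq v r; first by rewrite fr.
rewrite in_setD1 vB vr /=; have [<-|fvr] := eqVneq (f v) r; first by rewrite eqxx.
rewrite /= ifN //; move: vB; rewrite in_descendants (negPf vr) /=.
by apply: contraTneq => ->.
Qed.

End Split.

Section Glue.

Variables (S B : {set V}) (r : V) (f1 f2 : {ffun V -> V}).
Hypotheses (S0 : ord0 \notin S) (BS : B \subset S) (rB : r \in B).
Hypotheses (f1P : parent_fun (B :\ r) f1) (f2P : parent_fun (S :\: B) f2).
Let f := glue B r f1 f2.

Let B0 : ord0 \notin B.
Proof. by apply: contra S0; apply/subsetP. Qed.
Let r0 : r != ord0. Proof. by apply: contraNneq B0 => <-. Qed.
Let B10 : ord0 \notin B :\ r. Proof. by rewrite in_setD1 (negPf B0) andbF. Qed.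
Let B20 : ord0 \notin S :\: B. Proof. by rewrite in_setD (negPf S0) andbF. Qed.
Let f1_0 : f1 ord0 = ord0. Proof. by case/parent_funP: f1P => _ _; apply. Qed.
Let f1_r : f1 r = ord0.
Proof. by case/parent_funP: f1P => _ _; apply; rewrite setD11. Qed.
Let f2_0 : f2 ord0 = ord0. Proof. by case/parent_funP: f2P => _ _; apply. Qed.
Let f_r : f r = ord0. Proof. by rewrite ffunE rB eqxx. Qed.
Let f_0 : f ord0 = ord0. Proof. by rewrite ffunE (negPf B0). Qed.

Lemma glue_outside v j : v \notin B -> fconnect f v j = fconnect f2 v j.
Proof.
case/parent_funP: f2P => h1 h2 h3.
move: v; apply: (rooted_ind h1) => [_|v v0 IHv vB].
  by rewrite (fconnect_fixed _ f_0) (fconnect_fixed _ f2_0).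
rewrite fconnect_eqVf (fconnect_eqVf f2) ffunE (negPf vB) IHv //.
case: (boolP (v \in S :\: B)) => [/h2[->//|]|/h3->//].
by case/setDP.
Qed.

Lemma glue_inside v j : v \in B ->
  fconnect f v j = [|| j == ord0, j == r | fconnect f1 v j].
Proof.
case/parent_funP: f1P => h1 h2 h3.
move: v; apply: (rooted_ind h1) => [|v v0 IHv vB]; first by rewrite (negPf B0).
rewrite fconnect_eqVf (fconnect_eqVf f1).
have [->|vr] := eqVneq v r.
  rewrite f_r f1_r (fconnect_fixed _ f_0) (fconnect_fixed _ f1_0).
  rewrite !(eq_sym _ j); by case: (j == ord0); case: (j == r).
rewrite ffunE vB (negPf vr); have [fv|fv] := eqVneq (f1 v) ord0.
  rewrite fv (fconnect_eqVf f) f_r (fconnect_fixed _ f_0) (fconnect_fixed _ f1_0).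
  by rewrite !(eq_sym _ j); case: (j == ord0); case: (j == r); case: (j == v).
rewrite IHv; first by case: (v == j); rewrite ?orbT.
have: v \in B :\ r by rewrite in_setD1 vr.
by case/h2 => [e|/setD1P[]//]; rewrite e eqxx in fv.
Qed.

Lemma parent_fun_glue : parent_fun S f.
Proof.
case/parent_funP: (f1P) => h1 h2 h3; case/parent_funP: (f2P) => k1 k2 k3.
apply/parent_funP; split=> v.
- by case: (boolP (v \in B)) => vB; [rewrite glue_inside | rewrite glue_outside].
- move=> vS; rewrite ffunE; case: ifPn => vB.
    case: eqP => [|/eqP vr]; [by left|right].
    case: eqP => [_|fv]; first exact: (subsetP BS).
    have: v \in B :\ r by rewrite in_setD1 vr.
    by case/h2 => // /setD1P[_]; apply: subsetP.
  have: v \in S :\: B by rewrite in_setD vB.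
  by case/k2 => [|/setDP[]]; [left|right].
- move=> vS; rewrite ffunE ifN; last by apply: contra vS; apply: subsetP.
  by apply: k3; apply: contra vS => /setDP[].
Qed.

Lemma glue_root : f r = ord0. Proof. exact: f_r. Qed.

Lemma descendants_glue : descendants f r = B.
Proof.
apply/setP => v; rewrite inE; case: (boolP (v \in B)) => vB.
  by rewrite glue_inside // eqxx orbT.
rewrite glue_outside //; apply/negP => /(parent_fun_connect B20 f2P)/(_ r0).
case=> [e|[_]]; first by rewrite e rB in vB.
by rewrite in_setD rB.
Qed.

Lemma below_glue : below B r f = f1.
Proof.
case/parent_funP: f1P => h1 h2 h3.
apply/ffunP => v; rewrite !ffunE; case: (boolP (v \in B :\ r)) => vB; last by rewrite h3.
case/setD1P: (vB) => vr vB'; rewrite vB' (negPf vr).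
have [->|fv] := eqVneq (f1 v) ord0; first by rewrite eqxx.
case: (h2 _ vB) => [e|/setD1P[-> _]//].
by rewrite e eqxx in fv.
Qed.

Lemma outside_glue : outside B f = f2.
Proof.
case/parent_funP: f2P => h1 h2 h3.
apply/ffunP => v; rewrite !ffunE; case: (boolP (v \in B)) => vB //.
by rewrite h3 // in_setD vB.
Qed.

(** Between nonzero distinct vertices, gluing creates only the ancestor pairs [(v, r)] with [v] in
    [B], and such a pair is an inversion when [v < r]. Pairs with larger entry 0 do not exist. *)
Lemma inversions_glue :
  inversions f = #|[set v in B | v < r]| + (inversions f1 + inversions f2).
Proof.
rewrite /inversions !card_sum_nat.
(* The first count is also written as a sum over pairs, so that the identity can be checked pair by
   pair. *)
rewrite [X in (X + _)%N](_ : _ =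
    \sum_(ij : V * V) [&& ij.1 \in B, ij.2 == r & ij.1 < r]); last first.
  rewrite (eq_bigr (fun ij : V * V =>
      (fun i j => [&& i \in B, j == r & i < r] : nat) ij.1 ij.2)) //.
  rewrite -(pair_bigA _ (fun i j => [&& i \in B, j == r & i < r] : nat)) /=.
  apply: eq_bigr => i _; rewrite (bigD1 r) //= eqxx big1 ?addn0 => [|j /negPf->].
    by [].
  by rewrite andbF.
rewrite -!big_split /=; apply: eq_bigr => -[i j] _ /=.
case: (ltnP i j) => ij; last first.
  by have [<-|_] := eqVneq j r; rewrite ?andbF //= ltnNge ij andbF.
have j0 : j != ord0 by apply: contraTneq ij => ->.
have ij' : i != j by apply: contraTneq ij => ->; rewrite ltnn.
have i1 : fconnect f1 i j -> (i \in B :\ r) && (j \in B :\ r).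
  by case/(parent_fun_connect B10 f1P)/(_ j0) => [/eqP|[-> ->]//]; rewrite (negPf ij').
have i2 : fconnect f2 i j -> (i \in S :\: B) && (j \in S :\: B).
  by case/(parent_fun_connect B20 f2P)/(_ j0) => [/eqP|[-> ->]//]; rewrite (negPf ij').
case: (boolP (i \in B)) => iB; rewrite ?(glue_inside _ iB) ?(glue_outside _ iB).
  rewrite (negPf j0) /=; case: (boolP (fconnect f2 i j)) => [/i2|_].
    by rewrite in_setD iB.
  case: (eqVneq j r) => [e|jr] /=; last by rewrite add0n addn0.
  subst j; rewrite ij /=; case: (boolP (fconnect f1 i r)) => [/i1|//].
  by rewrite setD11 andbF.
case: (boolP (fconnect f1 i j)) => [/i1|//] /=.
by rewrite in_setD1 (negPf iB) andbF.
Qed.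

(** Gluing only gives new children to [r] and to 0. Hence every other vertex keeps its status, and
    [r] is a leaf exactly when nothing else lies in [B]. *)
Lemma leaves_glue :
  leaves S f = leaves (B :\ r) f1 + (B == [set r]) + leaves (S :\: B) f2.
Proof.
case/parent_funP: (f1P) => h1 h2 h3; case/parent_funP: (f2P) => k1 k2 k3.
have codE g (v : V) : (v \in codom g) = [exists w, g w == v].
  apply/codomP/existsP => [[w ->]|[w /eqP<-]]; by exists w.
have fB w : w \in B -> (f w \in B) || (f w == ord0).
  move=> wB; rewrite ffunE wB; case: eqP => [|/eqP wr]; first by rewrite eqxx orbT.
  case: eqP => [_|fw]; first by rewrite rB.
  have: w \in B :\ r by rewrite in_setD1 wr.
  by case/h2 => // /setD1P[_ ->].
have fNB w : w \notin B -> f w \notin B.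
  move=> wB; rewrite ffunE (negPf wB).
  case: (boolP (w \in S :\: B)) => [/k2[->//|]|/k3->//].
  by case/setDP.
rewrite /leaves -(cardsID B [set v in S | _]); congr (_ + _).
  rewrite (cardsD1 r) addnC; congr (_ + _).
    apply: eq_card => v; rewrite !inE.
    case: (eqVneq v r) => //= vr; case: (boolP (v \in B)) => vB; last by rewrite !andbF.
    rewrite (subsetP BS) //= andbT; congr (~~ _); rewrite !codE.
    apply: eq_existsb => w; case: (boolP (w \in B)) => wB.
      rewrite ffunE wB; case: (eqVneq w r) => [->|wr]; first by rewrite f1_r.
      have [->|//] := eqVneq (f1 w) ord0; rewrite (eq_sym r) (negPf vr).
      by apply/esym/negP => /eqP e; move: B0; rewrite e vB.
    rewrite h3; last by rewrite in_setD1 negb_and wB orbT.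
    have v0 : ord0 != v by apply: contraNneq B0 => ->.
    rewrite (negPf v0); apply/negP => /eqP e.
    by move: (fNB _ wB); rewrite e vB.
  rewrite !inE (subsetP BS) // rB andbT; congr (nat_of_bool _).
  rewrite codE; apply/existsPn/eqP => [hr|Br w].
    apply/setP => v; rewrite inE; apply/idP/eqP => [vB|->//].
    have: fconnect f v r by rewrite glue_inside // eqxx orbT.
    by case/fconnect_codom => // -[z /esym/eqP]; rewrite (negPf (hr z)).
  case: (boolP (w \in B)) => wB; last by apply: contraNneq (fNB _ wB) => ->.
  by move: wB; rewrite Br => /set1P->; rewrite f_r eq_sym.
apply: eq_card => v; rewrite !inE.
case: (boolP (v \in B)) => //= vB; case: (boolP (v \in S)) => //= vS.
congr (~~ _); rewrite !codE; apply: eq_existsb => w.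
have v0 : ord0 != v by apply: contraNneq S0 => ->.
case: (boolP (w \in B)) => wB; last by rewrite ffunE (negPf wB).
rewrite k3 ?in_setD ?wB // (negPf v0).
case/orP: (fB _ wB) => [|/eqP->]; last by rewrite (negPf v0).
by apply: contraTF => /eqP->.
Qed.

End Glue.

Local Open Scope ring_scope.

(** Reindexing along [glue], whose inverse on these forests is the pair [below], [outside]. *)
Lemma sum_parent_fun_glue (R : nmodType) S B r (G : {ffun V -> V} -> R) :
  ord0 \notin S -> B \subset S -> r \in B ->
  \sum_(f | [&& parent_fun S f, f r == ord0 & descendants f r == B]) G f =
  \sum_(f1 | parent_fun (B :\ r) f1) \sum_(f2 | parent_fun (S :\: B) f2)
     G (glue B r f1 f2).
Proof.
move=> S0 BS rB; rewrite pair_big /=.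
rewrite (reindex_onto (fun p => glue B r p.1 p.2)
                      (fun f => (below B r f, outside B f))) /=; last first.
  move=> f /and3P[fS /eqP fr /eqP <-].
  exact: (glue_split S0 fS (subsetP BS _ rB)).
apply: eq_bigl => -[f1 f2] /=; apply/andP/andP.
  case=> /and3P[fS /eqP fr /eqP dB] /eqP[e1 e2].
  move: (glue _ _ _ _) fS fr dB e1 e2 => f fS fr <- <- <-.
  have rS : r \in S by apply: (subsetP BS).
  split; [exact: (parent_fun_below r fS)|exact: (parent_fun_outside r fS)].
case=> f1P f2P; split; last by rewrite (below_glue _ f1P) (outside_glue _ _ f2P).
rewrite (parent_fun_glue S0 BS) //= (descendants_glue S0 BS) // eqxx andbT.
by rewrite (glue_root _ _ rB).
Qed.

Lemma root_exists f v : (forall v, fconnect f v ord0) -> v != ord0 ->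
  exists r, [/\ r != ord0, f r = ord0 & fconnect f v r].
Proof.
move=> h; move: v; apply: (rooted_ind h) => [|v v0 IHv _]; first by rewrite eqxx.
have [fv0|/IHv[r [r0 fr fvr]]] := eqVneq (f v) ord0.
  by exists v; rewrite connect0.
by exists r; rewrite fconnect_eqVf fvr orbT.
Qed.

Lemma root_unique f v r r' : f ord0 = ord0 -> f r = ord0 -> f r' = ord0 ->
  r != ord0 -> r' != ord0 -> fconnect f v r -> fconnect f v r' -> r = r'.
Proof.
move=> f0 fr fr' r0 r'0 /iter_findex; move: (findex f v r) => k er.
move=> /iter_findex; move: (findex f v r') => k' er'.
(* The one met first on the chain leads to the other, while the only vertex strictly above a child
   of the root is 0. *)
wlog le_kk' : k k' r r' fr fr' r0 r'0 er er' / (k <= k')%N.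
  case/orP: (leq_total k k') => le H; first exact: H le.
  by apply/esym; apply: H le.
have: fconnect f r r' by rewrite -er' -(subnK le_kk') iterD er fconnect_iter.
rewrite fconnect_eqVf fr (fconnect_fixed _ f0) (eq_sym ord0) (negPf r'0) orbF.
by move/eqP.
Qed.

(** * The signed forest polynomial and its quadratic recurrence *)

Definition forest_weight S f : {poly int} := (-1) ^+ inversions f * 'X^(leaves S f).

Definition forest_poly S : {poly int} :=
  \sum_(f | parent_fun S f) forest_weight S f.

(** The fixed vertex [m] lies below exactly one child [r] of the root. Forests are sorted by [r] and
    by the set [B] of its descendants, then cut there. *)
Lemma forest_poly_rec S m : ord0 \notin S -> m \in S ->
  forest_poly S = \sum_(B : {set V} | (m \in B) && (B \subset S)) \sum_(r in B)
    (-1) ^+ #|[set v in B | (v < r)%N]| *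
    (forest_poly (B :\ r) * 'X^(B == [set r])) * forest_poly (S :\: B).
Proof.
move=> S0 mS.
(* The inner sum has a single term, since [r] is determined by [f] and [m]. *)
transitivity (\sum_(f | parent_fun S f)
   \sum_(r | [&& r != ord0, f r == ord0 & fconnect f m r]) forest_weight S f).
  apply: eq_bigr => f fS; case/parent_funP: (fS) => h1 _ h3.
  have m0 : m != ord0 by apply: contraNneq S0 => <-.
  have [r [r0 fr fmr]] := root_exists h1 m0.
  rewrite (big_pred1 r) // => r'; apply/and3P/eqP => [[r'0 /eqP fr' fmr']|->].
    exact: (root_unique (h3 _ S0) fr' fr r'0 r0 fmr' fmr).
  by rewrite fr eqxx.
rewrite (exchange_big_dep (fun r => r \in S)) /=; last first.
  move=> f r fS /and3P[r0 _ fmr].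
  by case: (parent_fun_connect S0 fS fmr r0) => [<-|[]].
transitivity (\sum_(r in S) \sum_(B : {set V} | [&& m \in B, B \subset S & r \in B])
   \sum_(f | [&& parent_fun S f, f r == ord0 & descendants f r == B]) forest_weight S f).
  apply: eq_bigr => r rS; have r0 : r != ord0 by apply: contraNneq S0 => <-.
  rewrite (partition_big (fun f => descendants f r)
    (fun B => [&& m \in B, B \subset S & r \in B])) /=; last first.
    move=> f /and4P[fS _ fr fmr]; rewrite !inE fmr connect0 andbT.
    exact: (descendants_sub S0 fS rS).
  apply: eq_bigr => B /and3P[mB BS rB]; apply: eq_bigl => f.
  rewrite r0 /=; case: (f r == ord0); rewrite ?andbF //= -andbA; congr (_ && _).
  by case: eqP => [dB|_]; rewrite ?andbF //; move: mB; rewrite -dB inE => ->.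
rewrite (exchange_big_dep (fun B => (m \in B) && (B \subset S))) /=; last first.
  by move=> r B _ /and3P[-> ->].
apply: eq_bigr => B /andP[mB BS].
rewrite (eq_bigl (fun r => r \in B)) => [|r]; last first.
  by rewrite mB BS /=; case: (boolP (r \in B)) => rB; rewrite ?andbF // (subsetP BS).
apply: eq_bigr => r rB; rewrite sum_parent_fun_glue //.
rewrite exchange_big /= mulr_sumr; apply: eq_bigr => f2 f2P.
rewrite mulr_suml mulr_sumr mulr_suml; apply: eq_bigr => f1 f1P.
rewrite /forest_weight (inversions_glue S0 BS) // (leaves_glue S0 BS) //.
by rewrite !exprD; ring.
Qed.

End ParentFunctions.

(** * Trees and their parent functions *)

Lemma set2_eq (T : finType) (x y a b : T) : [set x; y] = [set a; b] ->
  (x = a /\ y = b) \/ (x = b /\ y = a).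
Proof.
move=> /setP e.
have := e x; rewrite !inE eqxx => /esym/orP[] /eqP xa.
  have := e b; have := e y; rewrite !inE !eqxx orbT xa => /esym/orP[] /eqP yb.
    by rewrite orbT yb orbb => /eqP <-; left.
  by left.
have := e a; have := e y; rewrite !inE !eqxx orbT xa => /esym/orP[] /eqP ya.
  by right.
by rewrite ya /= orbb => /eqP <-; left.
Qed.

Lemma adj_sym n (E : {set {set 'I_n.+1}}) : ssrbool.symmetric (adj E).
Proof. by move=> x y; rewrite /adj setUC. Qed.

Section TreeOf.

Variable n : nat.
Notation V := 'I_n.+1.
Implicit Types (f : {ffun V -> V}) (E : {set {set V}}).

Definition tree_of f : {set {set V}} := [set [set v; f v] | v in [set~ ord0]].

Section Edges.

Variable f : {ffun V -> V}.
Hypothesis fP : parent_fun [set~ ord0] f.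

Let f_reach v : fconnect f v ord0. Proof. by case/parent_funP: fP. Qed.
Let f0 : f ord0 = ord0. Proof. by case/parent_funP: fP => _ _; apply; rewrite setC11. Qed.
Let f_neq v : v != ord0 -> f v != v.
Proof. by move=> v0; apply: (parent_fun_neq _ fP); rewrite ?setC11. Qed.

Lemma adj_tree_of x y :
  adj (tree_of f) x y = (x != ord0) && (f x == y) || (y != ord0) && (f y == x).
Proof.
apply/imsetP/idP => [[v]|].
  rewrite !inE => v0 /set2_eq[[-> ->]|[-> ->]]; first by rewrite v0 eqxx.
  by rewrite v0 eqxx orbT.
case/orP => /andP[v0 /eqP <-]; first by exists x; rewrite ?inE.
by exists y; rewrite ?inE // setUC.
Qed.

Let depth v := findex f v ord0.
Let depthS v : v != ord0 -> depth v = (depth (f v)).+1.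
Proof. by move=> v0; rewrite /depth fconnect_findex // eq_sym. Qed.

(** Each application of [f] away from the root lowers the depth by one. This lets an edge determine
    which of its ends is the parent. *)
Lemma parent_fun_neq2 v : v != ord0 -> f (f v) != v.
Proof.
move=> v0; apply/eqP => e; have fv0 : f v != ord0.
  by apply: contraNneq v0 => fv; rewrite -e fv f0.
by have := depthS v0; rewrite (depthS fv0) e; lia.
Qed.

Lemma tree_of_connected : connected (tree_of f).
Proof.
have to0 v : connect (adj (tree_of f)) v ord0.
  move: v; apply: (rooted_ind f_reach) => [|v v0 IHv]; first exact: connect0.
  by apply: connect_trans IHv; apply: connect1; rewrite adj_tree_of v0 eqxx.
apply/forallP => u; apply/forallP => v; apply: connect_trans (to0 u) _.
by rewrite (sym_connect_sym (@adj_sym _ _)).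
Qed.

(** Both neighbours on the cycle of a vertex of greatest depth would have to be its parent, yet a
    cycle of length at least 3 has two distinct ones. *)
Lemma tree_of_acyclic : acyclic (tree_of f).
Proof.
apply/forallP => k; apply/implyP => k2; apply/forallP => c; apply/negP.
have sc : (2 < size c)%N by rewrite size_tuple.
have [x0 x0c] : exists x, x \in (c : seq V).
  by case: (tval c) sc => // x s _; exists x; rewrite mem_head.
have [v vc vmax] : exists2 v, v \in (c : seq V) &
    forall w, w \in (c : seq V) -> (depth w <= depth v)%N.
  by case: (@arg_maxnP _ x0 (mem (c : seq V)) depth x0c) => v vc vmax; exists v.
have [i s rc] := rot_to vc; rewrite /ucycleb -(rot_cycle i) -(rot_uniq i) rc.
have {}vmax w : w \in v :: s -> (depth w <= depth v)%N.
  by rewrite -rc mem_rot; apply: vmax.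
have {sc} : (2 < size (v :: s))%N by rewrite -rc size_rot.
have up w : w \in v :: s -> adj (tree_of f) v w -> w = f v.
  move=> wc; rewrite adj_tree_of => /orP[/andP[_ /eqP->]//|/andP[w0 /eqP fw]].
  by have := vmax w wc; rewrite (depthS w0) fw ltnn.
case: s rc vmax up => [|x [|y s]] // rc vmax up _ /andP[/=].
rewrite rcons_path => /and4P[vx xy ys lv] /andP[_ /andP[xs _]].
have xE : x = f v by apply: up; rewrite // !inE eqxx orbT.
have lE : last y s = f v by apply: up; rewrite ?(adj_sym _ v) // 2!in_cons mem_last !orbT.
by rewrite xE -lE mem_last in xs.
Qed.

Lemma tree_of_simple : simple_graph (tree_of f).
Proof.
apply/forallP => e; apply/implyP => /imsetP[v]; rewrite !inE => v0 ->.
by rewrite cards2 (eq_sym v) f_neq.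
Qed.

Lemma tree_of_Tree : tree_of f \in Tree n.
Proof. by rewrite inE tree_of_simple tree_of_connected tree_of_acyclic. Qed.

(** A path that has just stepped down from [f x] to [x] cannot turn back up without revisiting
    [f x], so it descends forever and misses the root. *)
Lemma down_path_last x q : x != ord0 -> path (adj (tree_of f)) x q ->
  uniq (f x :: x :: q) -> last x q != ord0.
Proof.
elim: q x => // y q IHq x x0 /= /andP[xy yq] /andP[fx /andP[xq uq]].
move: xy; rewrite adj_tree_of x0 /= => /orP[/eqP e|/andP[y0 /eqP fy]].
  by rewrite e !inE eqxx orbT in fx.
by apply: IHq => //=; rewrite fy xq.
Qed.

(** By [down_path_last] each step of a path to the root goes up, so the path is the chain of
    iterates of [f]. *)
Lemma mem_root_path i p j : path (adj (tree_of f)) i p -> uniq (i :: p) ->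
  last i p = ord0 -> (j \in i :: p) = fconnect f i j.
Proof.
elim: p i => [|x p IHp] i.
  by move=> _ _ /= ->; rewrite inE fconnect_fixed // eq_sym.
move=> /= /andP[ix xp] u l0; rewrite inE fconnect_eqVf (eq_sym j); congr (_ || _).
have u' : uniq (x :: p) by case/andP: u.
rewrite (IHp x xp u' l0).
move: ix; rewrite adj_tree_of => /orP[/andP[_ /eqP->]//|/andP[x0 /eqP e]].
by have := down_path_last x0 xp; rewrite e => /(_ u); rewrite l0 eqxx.
Qed.

Lemma on_path_tree_of i j : on_path_to_root (tree_of f) i j = fconnect f i j.
Proof.
apply/existsP/idP => [[k /existsP[p /and4P[ip up /eqP l0]]]|fij].
  by rewrite (mem_root_path j ip).
have /forallP/(_ i)/forallP/(_ ord0)/connectP[p0 ip0 l0] := tree_of_connected.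
case/shortenP: ip0 l0 => p ip up _ l0.
have sp : (size p < n.+1)%N.
  by have := max_card (mem (i :: p)); rewrite (card_uniqP up) card_ord.
exists (Ordinal sp); apply/existsP; exists (in_tuple p).
by rewrite ip up -l0 eqxx (mem_root_path j ip).
Qed.

Lemma inv_tree_of : Defs.inv (tree_of f) = inversions f.
Proof.
apply: eq_card => -[i j]; rewrite !inE on_path_tree_of /=.
(* [inversions] does not ask for [1 <= i], but from 0 only 0 is reached, which is not larger. *)
case: (posnP i) => //= i0; apply/esym/negP => /andP[ij].
have -> : i = ord0 by apply/val_inj.
by rewrite fconnect_fixed // => /eqP e; rewrite i0 -e in ij.
Qed.

Lemma lev_tree_of : lev (tree_of f) = leaves [set~ ord0] f.
Proof.
apply: eq_card => v; rewrite !inE; case: (eqVneq v ord0) => //= v0.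
apply/forallP/idP => [h|h u].
  apply/negP => /codomP[u vE]; have := h u; rewrite /is_child on_path_tree_of.
  rewrite adj_tree_of vE fconnect1 eqxx andbT (_ : u != ord0) //.
  by apply: contraNneq v0 => u0; rewrite vE u0 f0.
rewrite /is_child on_path_tree_of adj_tree_of.
have [e|_] /= := eqVneq (f u) v; first by rewrite -e codom_f in h.
rewrite andbF v0 /=; have [e|//] := eqVneq (f v) u.
apply/negP => fuv; have uv : u != v by rewrite -e f_neq.
have [|[z zE]] := fconnect_codom fuv; first by apply/eqP.
by rewrite zE codom_f in h.
Qed.

End Edges.

(** Induction from the root: the edge between [v] and [f v] is an edge of the tree of [g], so either
    [g v = f v] or [g (f v) = v]. The induction hypothesis turns the latter into [f (f v) = v],
    which is impossible. *)
Lemma tree_of_inj : {in parent_fun [set~ ord0] &, injective tree_of}.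
Proof.
move=> f g; rewrite !unfold_in => fP gP e; apply/ffunP.
case/parent_funP: (fP) => h1 _ h3; case/parent_funP: (gP) => k1 _ k3.
have f0 : f ord0 = ord0 by rewrite h3 // setC11.
have g0 : g ord0 = ord0 by rewrite k3 // setC11.
apply: (rooted_ind h1) => [|v v0 IHv]; first by rewrite f0 g0.
have: adj (tree_of g) v (f v) by rewrite -e adj_tree_of // v0 eqxx.
rewrite adj_tree_of // => /orP[/andP[_ /eqP//]|/andP[fv0]].
by rewrite -IHv (negPf (parent_fun_neq2 fP v0)).
Qed.

(** Breadth-first search: the parent is a neighbour at smaller distance [d] from the root. *)
Lemma spanning_parent_fun (e : rel V) : (forall v, connect e v ord0) ->
  exists f, parent_fun [set~ ord0] f /\ forall v, v != ord0 -> e v (f v).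
Proof.
move=> eP.
have dP v : exists k, [exists p : k.-tuple V, path e v p && (last v p == ord0)].
  have /connectP[p vp l0] := eP v; exists (size p); apply/existsP; exists (in_tuple p).
  by rewrite vp -l0 eqxx.
pose d v := ex_minn (dP v).
have closer v : v != ord0 -> exists w, e v w && (d w < d v).
  move=> v0; rewrite /d; case: (ex_minnP (dP v)) => k /existsP[p /andP[]] + + _.
  case: p => -[|w p] /= /eqP <-; first by move=> _ /eqP e0; rewrite e0 eqxx in v0.
  move=> /andP[vw wp] l0; exists w; rewrite vw /=.
  case: ex_minnP => j _; rewrite ltnS; apply.
  by apply/existsP; exists (in_tuple p); rewrite wp.
pose f := [ffun v => if v == ord0 then ord0 else
  odflt ord0 [pick w | e v w && (d w < d v)]].
have fE v : v != ord0 -> e v (f v) && (d (f v) < d v).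
  move=> v0; rewrite ffunE (negPf v0); case: pickP => [w //|h].
  by have [w] := closer v v0; rewrite h.
exists f; split=> [|v v0]; last by case/andP: (fE v v0).
apply/parent_funP; split=> [v|v _|v].
- move: {2}(d v).+1 (ltnSn (d v)) => k; elim: k v => // k IHk v dv.
  have [->|v0] := eqVneq v ord0; first exact: connect0.
  rewrite fconnect_eqVf IHk ?orbT //; case/andP: (fE v v0) => _ h.
  by apply: leq_trans h _.
- by rewrite !inE; case: eqP; [left|right].
- by rewrite !inE negbK => /eqP->; rewrite ffunE eqxx.
Qed.

(** A breadth-first spanning tree of [E] is all of [E]: a further edge would close the tree path
    between its ends to a cycle. *)
Lemma tree_of_surj E : E \in Tree n ->
  exists2 f, parent_fun [set~ ord0] f & E = tree_of f.
Proof.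
rewrite inE => /and3P[sE cE aE].
have [f [fP fE]] : exists f, parent_fun [set~ ord0] f /\
    forall v, v != ord0 -> adj E v (f v).
  by apply: spanning_parent_fun => v; move/forallP: cE => /(_ v)/forallP.
exists f => //.
have sub : subrel (adj (tree_of f)) (adj E).
  move=> x y; rewrite adj_tree_of // => /orP[/andP[x0 /eqP<-]|/andP[y0 /eqP<-]].
    exact: fE.
  by rewrite adj_sym fE.
apply/eqP; rewrite eqEsubset; apply/andP; split; last first.
  by apply/subsetP => _ /imsetP[v + ->]; rewrite !inE => /fE.
apply/subsetP => a aE'; apply: contraT => aT.
have: #|a| == 2 by move/forallP: sE => /(_ a); rewrite aE'.
case/cards2P=> u [v [uv aE0]]; subst a.
have /forallP/(_ u)/forallP/(_ v)/connectP[p0 up0 l0] := tree_of_connected fP.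
case/shortenP: up0 l0 => p up uup _ l0.
(* The ends differ, and a path of one step would put the extra edge into [tree_of f]; so the cycle
   has at least three vertices. *)
have sp : (2 < (size p).+1)%N.
  case: p up uup l0 => [|x [|//]] /=; first by move=> _ _ e; rewrite e eqxx in uv.
  by move=> /andP[ux _] _ xv; rewrite -xv in ux; rewrite /adj (negPf aT) in ux.
have sp' : ((size p).+1 < n.+2)%N.
  by have := max_card (mem (u :: p)); rewrite (card_uniqP uup) card_ord.
move/forallP: aE => /(_ (Ordinal sp'))/implyP/(_ sp)/forallP/(_ (in_tuple (u :: p))).
rewrite /ucycleb uup andbT /= rcons_path (sub_path sub up) -l0 adj_sym /=.
by rewrite /adj aE'.
Qed.

End TreeOf.

Local Open Scope ring_scope.

(** * The differential equation *)

Lemma iter_derivation (R : comNzRingType) (d : R -> R) :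
    {morph d : p q / p + q} -> (forall p q, d (p * q) = d p * q + p * d q) ->
  forall m p q, iter m d (p * q) =
    \sum_(k < m.+1) (iter k d p * iter (m - k) d q) *+ 'C(m, k).
Proof.
move=> dD dM m; elim: m => [|m IHm] p q.
  by rewrite big_ord_recl big_ord0 addr0 bin0.
have iterD k x y : iter k d (x + y) = iter k d x + iter k d y.
  by elim: k => //= k ->; rewrite dD.
rewrite iterSr dM iterD !IHm [RHS]big_ord_recl bin0.
rewrite [X in _ + X]big_ord_recl bin0 addrCA /= subn0 -iterSr -/(iter m.+1 d q).
congr (_ + _).
under [X in _ = X]eq_bigr do rewrite /= binS mulrnDr subSS -/(iter _ d (d p)).
rewrite big_split /= addrC; congr (_ + _).
  rewrite [RHS]big_ord_recr /= bin_small // mulr0n addr0.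
  apply: eq_bigr => i _; rewrite /bump /= add1n -iterSr -subSn //.
by apply: eq_bigr => i _; rewrite add0n -iterS -iterSr.
Qed.

(** A derivation along [phi] is determined by its values on the variables. This reduces [eps_delta]
    (with [phi] the identity) and [ev_eps] (with [phi] the evaluation) to three checks each. *)
Lemma mpoly_derivation_eq0 n (R : comNzRingType) (phi D : {mpoly int[n]} -> R) :
    {morph D : p q / p + q} -> (forall p q, D (p * q) = D p * phi q + phi p * D q) ->
    phi 1 = 1 -> (forall i, D 'X_i = 0) -> forall p, D p = 0.
Proof.
move=> DD DM phi1 DX.
have D0 : D 0 = 0 by apply: (addIr (D 0)); rewrite -DD !add0r.
have D1 : D 1 = 0.
  by apply: (addIr (D 1)); rewrite add0r -[in RHS](mulr1 1) DM phi1 mulr1 mul1r.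
have DN p : D (- p) = - D p.
  by apply: (addIr (D p)); rewrite -DD !addNr.
have Dn p k : D (p *+ k) = D p *+ k.
  by elim: k => [|k IHk]; rewrite ?mulr0n // !mulrS DD IHk.
apply: mpolyind => // c m p _ _ Dp; rewrite DD Dp addr0.
suff DXm : D 'X_[m] = 0.
  (* Integer scalars are repeated sums, so additivity takes care of them. *)
  have -> : c *: 'X_[m] = 'X_[m] *~ c :> {mpoly int[n]} by rewrite -scaler_int intz.
  by case: c => k; rewrite ?NegzE ?mulrNz ?DN -pmulrn Dn DXm mul0rn ?oppr0.
rewrite mpolyXE_id; apply: (big_ind (fun x => D x = 0)) => // [x y x0 y0|i _].
  by rewrite DM x0 y0 mul0r mulr0 addr0.
by elim: (m i) => // k IHk; rewrite exprS DM DX IHk mul0r mulr0 addr0.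
Qed.

Section VectorField.

Variable n : nat.
Implicit Types (a : 'I_n -> {mpoly int[n]}) (p q : {mpoly int[n]}).

Definition vfield a p : {mpoly int[n]} := \sum_i a i * p^`M(i).

Lemma vfieldD a : {morph vfield a : p q / p + q}.
Proof.
by move=> p q; rewrite -big_split; apply: eq_bigr => i _; rewrite mderivD mulrDr.
Qed.

Lemma vfieldM a p q : vfield a (p * q) = vfield a p * q + p * vfield a q.
Proof.
rewrite mulr_suml mulr_sumr -big_split; apply: eq_bigr => i _ /=.
by rewrite mderivM; ring.
Qed.

Lemma vfieldX a i : vfield a 'X_i = a i.
Proof.
rewrite /vfield (bigD1 i) //= big1 ?addr0 => [|j ji]; rewrite mderivX mnmE.
  rewrite eqxx scale1r -[RHS]mulr1 -mpolyX0; congr (_ * 'X_[_]).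
  by apply/mnmP => k; rewrite mnmBE subnn mnm0E.
by rewrite eq_sym (negPf ji) scale0r mulr0.
Qed.

Lemma vfieldMn a p k : vfield a (p *+ k) = vfield a p *+ k.
Proof.
by rewrite -sumrMnl; apply: eq_bigr => i _; rewrite mderivMn mulrnAr.
Qed.

Lemma vfieldN a p : vfield a (- p) = - vfield a p.
Proof. by rewrite -sumrN; apply: eq_bigr => i _; rewrite mderivN mulrN. Qed.

End VectorField.

(** * The derivations [delta] and [eps], and the passage to a linear recurrence *)

Section Riccati.

Let i0 : 'I_3 := inord 0.
Let i1 : 'I_3 := inord 1.
Let i2 : 'I_3 := inord 2.
Notation A := {mpoly int[3]}.
Let c : A := 'X_i0.
Let y : A := 'X_i1.
Let u : A := 'X_i2.
Let coords (a b d : A) : 'I_3 -> A := fun i => nth 0 [:: a; b; d] i.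
(* Scaled by 2 to keep integer coefficients, so that delta^n y is 2^n F_n at    *)
(* y = u = 1, c = t - 1; eps is homogenized (y u for 1) in order that the      *)
(* commutation relation holds without imposing y u = 1.                        *)
Let delta : A -> A := vfield (coords 0 (y * (y + u + c *+ 2)) (- (u * (y + u + c *+ 2)))).
Let eps : A -> A :=
  vfield (coords ((y * u - c ^+ 2) *+ 2) (y * (y - u)) (u * (u - y))).
Let ev : A -> {poly int} := mmap intr (fun i => nth 0 [:: 'X - 1; 1; 1] i).

Let coordsE a b d : (coords a b d i0 = a) * (coords a b d i1 = b) * (coords a b d i2 = d).
Proof. by rewrite /coords !inordK. Qed.

Let dc : delta c = 0. Proof. by rewrite /delta vfieldX coordsE. Qed.
Let dy : delta y = y * (y + u + c *+ 2). Proof. by rewrite /delta vfieldX coordsE. Qed.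
Let du : delta u = - (u * (y + u + c *+ 2)).
Proof. by rewrite /delta vfieldX coordsE. Qed.
Let ec : eps c = (y * u - c ^+ 2) *+ 2. Proof. by rewrite /eps vfieldX coordsE. Qed.
Let ey : eps y = y * (y - u). Proof. by rewrite /eps vfieldX coordsE. Qed.
Let eu : eps u = u * (u - y). Proof. by rewrite /eps vfieldX coordsE. Qed.
Let deltaD p q : delta (p + q) = delta p + delta q. Proof. exact: vfieldD. Qed.
Let deltaM p q : delta (p * q) = delta p * q + p * delta q. Proof. exact: vfieldM. Qed.
Let deltaN p : delta (- p) = - delta p. Proof. exact: vfieldN. Qed.
Let deltaMn p k : delta (p *+ k) = delta p *+ k. Proof. exact: vfieldMn. Qed.
Let epsD p q : eps (p + q) = eps p + eps q. Proof. exact: vfieldD. Qed.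
Let epsM p q : eps (p * q) = eps p * q + p * eps q. Proof. exact: vfieldM. Qed.
Let epsN p : eps (- p) = - eps p. Proof. exact: vfieldN. Qed.
Let epsMn p k : eps (p *+ k) = eps p *+ k. Proof. exact: vfieldMn. Qed.
Let evD p q : ev (p + q) = ev p + ev q. Proof. exact: mmapD. Qed.
Let evN p : ev (- p) = - ev p. Proof. exact: mmapN. Qed.
Let evMn p k : ev (p *+ k) = ev p *+ k. Proof. exact: mmapMn. Qed.
Let evM p q : ev (p * q) = ev p * ev q. Proof. exact: rmorphM. Qed.
Let ev_sum m (F : 'I_m -> A) : ev (\sum_i F i) = \sum_i ev (F i).
Proof. exact: raddf_sum. Qed.
Let ev0 : ev 0 = 0. Proof. exact: mmap0. Qed.
Let ev1 : ev 1 = 1. Proof. exact: rmorph1. Qed.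
Let d1 : (1 : {poly int})^`() = 0. Proof. exact: derivC. Qed.
Let evc : ev c = 'X - 1. Proof. by rewrite /ev mmapX mmap1U inordK. Qed.
Let evy : ev y = 1. Proof. by rewrite /ev mmapX mmap1U inordK. Qed.
Let evu : ev u = 1. Proof. by rewrite /ev mmapX mmap1U inordK. Qed.

Let var_ind (P : A -> Prop) : P c -> P y -> P u -> forall i, P 'X_i.
Proof.
move=> Pc Py Pu [[|[|[|//]]] h].
- by rewrite (_ : Ordinal h = i0) //; apply/val_inj; rewrite /= inordK.
- by rewrite (_ : Ordinal h = i1) //; apply/val_inj; rewrite /= inordK.
- by rewrite (_ : Ordinal h = i2) //; apply/val_inj; rewrite /= inordK.
Qed.

(** The difference of the two sides is a commutator of derivations plus a multiple of [delta], hence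
    a derivation, and it vanishes on [c], [y] and [u]. *)
Lemma eps_delta p : eps (delta p) = delta (eps p) - (c * delta p) *+ 2.
Proof.
apply/eqP; rewrite -subr_eq0; apply/eqP.
apply: (@mpoly_derivation_eq0 _ A id (fun p => eps (delta p) -
  (delta (eps p) - (c * delta p) *+ 2))) => //.
- by move=> q r /=; rewrite !(deltaD, epsD); ring.
- by move=> q r /=; rewrite !(deltaM, epsM, deltaD, epsD); ring.
apply: (@var_ind (fun x => eps (delta x) - (delta (eps x) - (c * delta x) *+ 2) = 0)).
- rewrite dc ec deltaMn deltaD deltaN expr2 !deltaM dc dy du /eps.
  by rewrite -(mulr0n 0) vfieldMn; ring.
- by rewrite dy ey !(deltaM, epsM, deltaD, epsD, epsMn, deltaN) dy du ec ey eu; ring.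
- rewrite du eu !(deltaM, epsM, deltaD, epsD, epsMn, epsN, deltaN) dy du ec ey eu.
  by ring.
Qed.

(** Both sides are derivations along [ev] that agree on the variables. This is how the derivative in
    t enters: under evaluation [eps] acts as [2 (2 t - t^2) d/dt]. *)
Lemma ev_eps p : ev (eps p) = ((1 - ('X - 1) ^+ 2) * (ev p)^`()) *+ 2.
Proof.
apply/eqP; rewrite -subr_eq0; apply/eqP.
apply: (@mpoly_derivation_eq0 _ _ ev (fun p => ev (eps p) -
  ((1 - ('X - 1) ^+ 2) * (ev p)^`()) *+ 2)) => //.
- by move=> q r /=; rewrite epsD !evD derivD; ring.
- by move=> q r /=; rewrite epsM !(evM, evD) derivM; ring.
apply: (@var_ind (fun x => ev (eps x) - ((1 - ('X - 1) ^+ 2) * (ev x)^`()) *+ 2 = 0)).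
- rewrite ec evMn evD evN expr2 !evM evc evy evu derivB derivX d1.
  by ring.
- by rewrite ey evM evD evN evy evu d1; ring.
- by rewrite eu evM evD evN evy evu d1; ring.
Qed.

Definition riccati k : {poly int} := ev (iter k delta y).

Lemma riccati_rec0 : riccati 0 = 1. Proof. exact: evy. Qed.

Let iter_delta0 k : iter k delta 0 = 0.
Proof.
elim: k => //= k ->; apply: (addIr (delta 0)).
by rewrite -deltaD !add0r.
Qed.

Let iter_deltaD k p q : iter k delta (p + q) = iter k delta p + iter k delta q.
Proof. by elim: k => //= k ->. Qed.

Let iter_deltaMn k p j : iter k delta (p *+ j) = iter k delta p *+ j.
Proof. by elim: k => //= k ->. Qed.

Let iter_delta_c k : iter k delta c = if k == 0%N then c else 0.
Proof. by case: k => // k; rewrite iterSr dc iter_delta0. Qed.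

(** The coefficient form of [1/f = f(-x)]. The Leibniz expansions for [y] and [u] are compared term
    by term under strong induction. *)
Let evN1 k : ev (iter k delta u) = (-1) ^+ k * riccati k.
Proof.
have dN p j : iter j delta (- p) = - iter j delta p.
  by elim: j => //= j ->; rewrite deltaN.
elim/ltn_ind: k => -[_|k IHk]; first by rewrite expr0 mul1r /= evu [RHS]evy.
rewrite iterSr du dN /riccati iterSr dy.
rewrite !(iter_derivation (fun p q => deltaD p q) (fun p q => deltaM p q)).
rewrite evN !ev_sum -sumrN mulr_sumr.
apply: eq_bigr => i _ /=.
have ik : (i <= k)%N by rewrite -ltnS.
rewrite !evMn !evM !iter_deltaD !iter_delta_c !evD.
rewrite !IHk ?ltnS ?leq_subr //.
rewrite -/(riccati i) -/(riccati (k - i)) exprS.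
have -> : (-1) ^+ k = (-1) ^+ i * (-1) ^+ (k - i) :> {poly int} by rewrite -exprD subnKC.
(* The constant [c] survives only in the undifferentiated factor. Otherwise the factor from [y + u]
   carries [1 + (-1)^(k - i)]: it vanishes for odd [k - i], and for even [k - i] the extra sign is
   1. *)
case: eqP => [->|_]; first by rewrite expr0; ring.
rewrite ev0 !addr0 -[(-1) ^+ (k - i)]signr_odd; case: odd; rewrite ?expr1 ?expr0; ring.
Qed.

(** Leibniz expansion of [delta y]; by [evN1] the factor [y + u] yields twice the even part of [f],
    and [c] contributes only at [i = k]. *)
Lemma riccati_rec k : riccati k.+1 =
  \sum_(i < k.+1) (riccati i * (riccati (k - i) * (1 + (-1) ^+ (k - i)) +
                   ('X - 1) *+ ((k == i :> nat) * 2))) *+ 'C(k, i).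
Proof.
rewrite {1}/riccati iterSr dy.
rewrite !(iter_derivation (fun p q => deltaD p q) (fun p q => deltaM p q)).
rewrite ev_sum; apply: eq_bigr => i _ /=.
rewrite !evMn !evM !iter_deltaD !iter_delta_c !evD evN1.
rewrite -/(riccati i) -/(riccati (k - i)) subn_eq0.
have -> : (k <= i)%N = (k == i) by rewrite eqn_leq -(ltnS i) ltn_ord andbT.
by case: eqP => _; rewrite ?evc ?ev0 ?mul1n ?mul0n ?mulr0n; congr (_ *+ _); ring.
Qed.

(** Evaluate [eps] of [delta^k y] in two ways: by [ev_eps] it is a derivative in t, and by moving
    [eps] inside it becomes [delta^k (eps y)] with a multiple of [c]. *)
Lemma riccati_linear k : (0 < k)%N -> riccati k.+1 =
  (('X - 1) * riccati k) *+ (k.+1 * 2) + ((1 - ('X - 1) ^+ 2) * (riccati k)^`()) *+ 2.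
Proof.
have comm j p : eps (iter j delta p) =
    iter j delta (eps p) - (c * iter j delta p) *+ (j * 2).
  elim: j => [|j IHj]; first by rewrite mulr0n subr0.
  rewrite iterS eps_delta IHj deltaD deltaN deltaMn deltaM dc mulSn !mulrnDr /=.
  by ring.
have dN p j : iter j delta (- p) = - iter j delta p.
  by elim: j => //= j ->; rewrite deltaN.
have dcM p j : iter j delta (c * p) = c * iter j delta p.
  by elim: j => //= j ->; rewrite deltaM dc mul0r add0r.
have dyu : delta (y * u) = 0 by rewrite deltaM dy du; ring.
case: k => // k _; rewrite -ev_eps comm ey.
(* Writing [eps y] through [delta y] makes [riccati k.+1] appear; the product of [y] and [u] is
   killed by [delta], hence by its positive powers. *)
have -> : y * (y - u) = delta y - (y * u) *+ 2 - (c * y) *+ 2 by rewrite dy; ring.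
rewrite !iter_deltaD !dN !iter_deltaMn dcM (iterSr k _ (y * u)) dyu iter_delta0.
rewrite mul0rn subr0 2!evD !evN !evMn evM evc -iterSr -!/(riccati _).
by rewrite mulSn !mulrnDr; ring.
Qed.

End Riccati.

(** * Recurrences for the signed tree polynomial *)

Lemma sum_subsets_card (T : finType) (R : nmodType) (A : {set T}) (G : nat -> R) :
  \sum_(C : {set T} | C \subset A) G #|C| = \sum_(i < #|A|.+1) G i *+ 'C(#|A|, i).
Proof.
rewrite (partition_big (fun C : {set T} => inord #|C| : 'I_#|A|.+1) predT) //=.
apply: eq_bigr => i _; rewrite -cards_draws -sumr_const.
apply: eq_big => [C|C /andP[CA /eqP <-]]; last by rewrite inordK ?ltnS ?subset_leq_card.
rewrite inE; case: (boolP (C \subset A)) => //= CA.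
by rewrite -val_eqE /= inordK ?ltnS ?subset_leq_card.
Qed.

(** The exponent is the rank of [r] in [B], so this is [1 - 1 + 1 - ...] with one term per element;
    the induction removes the maximum, which changes no other rank. *)
Lemma sum_sign_rank n (B : {set 'I_n}) (R : comNzRingType) :
  \sum_(r in B) (-1) ^+ #|[set v in B | (v < r)%N]| = (odd #|B|)%:R :> R.
Proof.
move: {2}#|B| (erefl #|B|) => k; elim: k B => [|k IHk] B cB.
  by rewrite (cards0_eq cB) big_set0 cards0.
have [x0 x0B] : exists x, x \in B by apply/card_gt0P; rewrite cB.
have [x xB xmax] : exists2 x, x \in B & forall v, v \in B -> (v <= x)%N.
  by case: (arg_maxnP (fun v : 'I_n => v : nat) x0B) => x xB xmax; exists x.
have cBx : #|B :\ x| = k by move: cB; rewrite (cardsD1 x) xB => -[].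
rewrite (big_setD1 x) //= (_ : [set v in B | (v < x)%N] = B :\ x); last first.
  apply/setP => v; rewrite !inE andbC.
  case: (boolP (v \in B)) => vB; rewrite ?andbF // !andbT.
  by rewrite ltn_neqAle -val_eqE; move: (xmax v vB) => /= ->; rewrite andbT.
rewrite (eq_bigr (fun r : 'I_n => (-1) ^+ #|[set v in B :\ x | (v < r)%N]|)); last first.
  move=> r /setD1P[_ rB]; congr (_ ^+ _); apply: eq_card => v; rewrite !inE.
  case: eqP => // ->; case: ltnP => //; rewrite ?andbF //.
  by move: (xmax r rB) => /= h1 h2; move: (leq_trans h2 h1); rewrite ltnn.
rewrite IHk ?cBx // cB /= -signr_odd; case: odd; rewrite ?expr1 ?addNr //.
by rewrite expr0 addr0.
Qed.

(** Strong induction matching [forest_poly_rec] with [riccati_rec]; in particular [forest_poly S]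
    depends only on the size of [S]. *)
Lemma forest_poly_riccati n k (S : {set 'I_n.+1}) : #|S| = k -> ord0 \notin S ->
  forest_poly S *+ 2 ^ k = riccati k.
Proof.
elim/ltn_ind: k S => -[|k] IHk S cS S0.
  rewrite (cards0_eq cS) mulr1n riccati_rec0 /forest_poly.
  have P0 (f : {ffun 'I_n.+1 -> 'I_n.+1}) : parent_fun set0 f = (f == [ffun=> ord0]).
    apply/parent_funP/eqP => [[_ _ h]|->].
      by apply/ffunP => v; rewrite ffunE h ?inE.
    split=> v; rewrite ?inE ?ffunE //.
    by rewrite fconnect_eqVf ffunE connect0 orbT.
  rewrite (big_pred1 _ P0) /forest_weight /leaves.
  rewrite (_ : [set v in set0 | _] = set0); last by apply/setP => v; rewrite !inE.
  rewrite /inversions (_ : [set _ | _] = set0) ?cards0 ?expr0 ?mulr1 //.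
  apply/setP => -[i j]; rewrite !inE /=; apply/negP => /andP[ij].
  rewrite fconnect_eqVf ffunE -val_eqE (ltn_eqF ij) /= fconnect_fixed ?ffunE //.
  by move=> /eqP e; rewrite -e in ij.
have [m mS] : exists m, m \in S by apply/card_gt0P; rewrite cS.
rewrite (forest_poly_rec S0 mS) riccati_rec.
have cSm : #|S :\ m| = k by move: cS; rewrite (cardsD1 m) mS => -[].
rewrite -[in RHS]cSm.
rewrite -(sum_subsets_card (S :\ m) (fun i => riccati i * (riccati (#|S :\ m| - i) *
  (1 + (-1) ^+ (#|S :\ m| - i)) + ('X - 1) *+ ((#|S :\ m| == i) * 2)))).
(* The blocks containing [m] are the complements of the subsets [C] of [S :\ m], and [#|C|] is the
   index of [riccati_rec]. *)
rewrite (reindex_onto (fun C => S :\: C) (fun B => S :\: B)); last first.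
  by move=> B /andP[_ BS]; rewrite setDDr setDv set0U; apply/setIidPr.
rewrite -sumrMnl; apply: eq_big => [C|C /andP[/andP[mSC _] /eqP CS]].
  rewrite subsetDl andbT in_setD mS andbT subsetD1 andbC; congr (_ && _).
  rewrite setDDr setDv set0U; apply/eqP/idP => [<-|]; [exact: subsetIl | exact: setIidPr].
rewrite CS; have {}CS : C \subset S by rewrite -CS subsetDl.
have mC : m \notin C by move: mSC; rewrite in_setD mS andbT.
have cC : (#|C| <= k)%N.
  by rewrite -cSm subset_leq_card // subsetD1 CS.
set B := S :\: C.
have cB : #|B| = (k - #|C|).+1.
  by move: (cardsID C S); rewrite (setIidPr CS) cS -/B; lia.
have B0 : ord0 \notin B by rewrite in_setD (negPf S0) andbF.
have C0 : ord0 \notin C by apply: contra S0; apply/subsetP.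
have eC : forest_poly C *+ 2 ^ #|C| = riccati #|C| by rewrite IHk.
(* The power of 2 is shared between [B :\ r] and [C]; the factor 2 left over belongs to [r]. *)
rewrite -eC cSm (_ : (2 ^ k.+1 = 2 * 2 ^ (k - #|C|) * 2 ^ #|C|)%N); last first.
  by rewrite -mulnA -expnD subnK // expnS.
have kC : (k == #|C|) = (k - #|C| == 0)%N by rewrite subn_eq0 eqn_leq cC andbT.
have jk : (k - #|C| < k.+1)%N by rewrite ltnS leq_subr.
rewrite kC; move: (k - #|C|)%N (IHk _ jk) cB => j IHj cB.
have {}IHj r : r \in B -> forest_poly (B :\ r) *+ 2 ^ j = riccati j.
  move=> rB; apply: IHj; last by rewrite in_setD1 (negPf B0) andbF.
  by move: cB; rewrite (cardsD1 r) rB => -[].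
transitivity (\sum_(r in B) (-1) ^+ #|[set v in B | (v < r)%N]| *
    ((riccati j *+ 2 * 'X^(j == 0%N)) * (forest_poly C *+ 2 ^ #|C|))).
  rewrite -sumrMnl; apply: eq_bigr => r rB.
  rewrite -(IHj r rB) (_ : B == [set r] = (j == 0)%N).
    by move: (2 ^ j)%N (2 ^ #|C|)%N => a b; ring.
  by rewrite eq_sym eqEcard sub1set rB cards1 cB ltnS leqn0.
rewrite -mulr_suml sum_sign_rank cB mulrA mulrC; congr (_ * _).
rewrite /= -signr_odd.
(* For [j = 0] the leaf [r] gives [2 t = 2 + 2 (t - 1)]; for [j > 0], [1 + (-1)^j] is 2 or 0
   according to the parity of [j]. *)
have [->|j0] := eqVneq j 0%N; first by rewrite riccati_rec0 /= expr0 expr1; ring.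
by rewrite mul0n mulr0n addr0; case: odd; rewrite ?expr0 ?expr1 /=; ring.
Qed.

Definition tree_poly n : {poly int} := forest_poly [set~ ord0 : 'I_n.+1].

Lemma tree_poly_riccati n : tree_poly n *+ 2 ^ n = riccati n.
Proof.
apply: forest_poly_riccati; last by rewrite setC11.
by rewrite cardsC1 card_ord.
Qed.

Lemma poly_mulrnI (R : numDomainType) k : (0 < k)%N ->
  injective (fun p : {poly R} => p *+ k).
Proof.
move=> k0 p q /polyP e; apply/polyP => i.
by apply: (Num.Theory.pmulrnI k0); rewrite -!coefMn.
Qed.

Lemma tree_poly1 : tree_poly 1 = 'X.
Proof.
apply: (@poly_mulrnI _ 2) => //.
rewrite /= [LHS]tree_poly_riccati riccati_rec big_ord1 riccati_rec0 bin0 /= expr0.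
by ring.
Qed.

Lemma tree_polyS n : (0 < n)%N -> tree_poly n.+1 =
  (('X - 1) * tree_poly n) *+ n.+1 + (1 - ('X - 1) ^+ 2) * (tree_poly n)^`().
Proof.
move=> n0; apply: (@poly_mulrnI _ (2 ^ n.+1)); first by rewrite expn_gt0.
rewrite /= tree_poly_riccati riccati_linear // -tree_poly_riccati derivMn expnS.
by move: (2 ^ n)%N => a; ring.
Qed.

(** * Simsun permutations *)

Section Words.

Definition descent_at (u : seq nat) i :=
  (i.+1 < size u)%N && (nth 0%N u i.+1 < nth 0%N u i)%N.

Lemma has_double_descentP u :
  reflect (exists i, descent_at u i && descent_at u i.+1) (has_double_descent u).
Proof.
apply: (iffP hasP) => [[i _ /and4P[i0 h1 h2 h3]]|[i /andP[/andP[h1 h2] /andP[h3 h4]]]].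
  by exists i.-1; rewrite /descent_at prednK // h1 h2 h3 (ltnW h1).
exists i.+1; first by rewrite mem_iota.
by apply/and4P.
Qed.

Definition insert_letter (x : nat) (u : seq nat) i := take i u ++ x :: drop i u.

Lemma nth_insert_letter x u i j : (i <= size u)%N ->
  nth 0%N (insert_letter x u i) j =
  if (j < i)%N then nth 0%N u j else if j == i then x else nth 0%N u j.-1.
Proof.
move=> iu; rewrite nth_cat size_takel //; case: ltnP => ji; first by rewrite nth_take.
case: eqP => [->|/eqP ne]; first by rewrite subnn.
have ij : (i < j)%N by rewrite ltn_neqAle eq_sym ne ji.
by rewrite -(subnSK ij) /= nth_drop; congr nth; lia.
Qed.

Lemma size_insert_letter x u i : size (insert_letter x u i) = (size u).+1.
Proof. by rewrite size_cat /= addnS -size_cat cat_take_drop. Qed.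

Variables (u : seq nat) (x i : nat).
Hypotheses (iu : (i <= size u)%N) (ux : forall j, (nth 0%N u j < x)%N).

Lemma descent_at_insert j : descent_at (insert_letter x u i) j =
  if (j.+1 < i)%N then descent_at u j else if j.+1 == i then false
  else if j == i then (i < size u)%N else descent_at u j.-1.
Proof.
rewrite /descent_at size_insert_letter !nth_insert_letter // ltnS.
case: (ltngtP j.+1 i) => ji.
- by congr (_ && _); lia.
- case: (ltngtP j i) => ji'; [lia| |].
    by case: j ji ji' => // j _ _; rewrite /= ltnS.
  by subst j; rewrite ux andbT.
- by rewrite [X in _ && X]ltnNge (ltnW (ux _)) andbF.
Qed.

(** The new maximum is never preceded by a descent, so a new double descent must start at it; this
    happens when the letter it precedes is a descent top. *)
Lemma has_double_descent_insert : ~~ has_double_descent u ->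
  has_double_descent (insert_letter x u i) = descent_at u i.
Proof.
move=> ndd; have nd j : descent_at u j && descent_at u j.+1 = false.
  by apply: contraNF ndd => h; apply/has_double_descentP; exists j.
apply/has_double_descentP/idP => [[j]|dui].
  rewrite !descent_at_insert; case: (ltngtP j.+1 i) => ji //.
    by case: (ltngtP j.+2 i) => jj; rewrite ?nd ?andbF //; lia.
  have -> : (j.+2 < i)%N = false by lia.
  have -> : (j.+2 == i) = false by lia.
  have [->|ne] := eqVneq j i; first by case/andP.
  by case: j ji ne => [|j] /= ji ne; [lia|rewrite nd].
exists i; rewrite !descent_at_insert.
have -> : (i.+1 < i)%N = false by lia.
have -> : (i.+2 < i)%N = false by lia.
have -> : (i.+1 == i) = false by lia.
have -> : (i.+2 == i) = false by lia.
by rewrite eqxx dui andbT; case/andP: dui => h _; apply: ltn_trans h.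
Qed.

End Words.

Lemma size_one_line m (w : 'S_m) : size (one_line w) = m.
Proof. by rewrite size_map size_enum_ord. Qed.

Lemma nth_one_line m (w : 'S_m) (i : 'I_m) : nth 0%N (one_line w) i = (w i).+1.
Proof. by rewrite (nth_map i) ?size_enum_ord // nth_ord_enum. Qed.

Lemma one_line_lt m (w : 'S_m) j : (nth 0%N (one_line w) j < m.+1)%N.
Proof.
case: (ltnP j m) => jm; last by rewrite nth_default ?size_one_line.
by rewrite (nth_one_line w (Ordinal jm)) ltnS.
Qed.

Lemma one_line_lift m (i : 'I_m.+1) (s : 'S_m) :
  one_line (lift_perm i ord_max s) = insert_letter m.+1 (one_line s) i.
Proof.
have im : (i <= m)%N by rewrite -ltnS.
apply: (@eq_from_nth _ 0%N) => [|j]; first by rewrite size_insert_letter !size_one_line.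
rewrite size_one_line => jm; rewrite nth_insert_letter ?size_one_line //.
rewrite (nth_one_line _ (Ordinal jm)) -[j]/(val (Ordinal jm)).
case: (unliftP i (Ordinal jm)) => [k|] ->; last by rewrite lift_perm_id ltnn eqxx.
rewrite lift_perm_lift lift_max /= /bump.
case: (leqP i k) => ik; rewrite ?add1n ?add0n ?ik ?nth_one_line //=.
by rewrite ltnNge leqW //= gtn_eqF ?ltnS // nth_one_line.
Qed.

(** Every permutation arises once by inserting the largest letter; injectivity suffices, as both
    sides have [(m + 1)!] elements. *)
Lemma sum_lift_perm m (R : nmodType) (F : 'S_m.+1 -> R) :
  \sum_w F w = \sum_(s : 'S_m) \sum_(i < m.+1) F (lift_perm i ord_max s).
Proof.
rewrite pair_bigA /= (reindex (fun p : 'S_m * 'I_m.+1 => lift_perm p.2 ord_max p.1)) //.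
apply/onW_bij/inj_card_bij; last by rewrite card_prod !card_Sn card_ord factS mulnC.
move=> [s i] [s' i'] /= e.
have ei : i = i'.
  apply: (@perm_inj _ (lift_perm i' ord_max s')).
  by rewrite -{1}e !lift_perm_id.
subst i'; congr (_, _); apply/permP => k.
by apply: (@lift_inj _ ord_max); rewrite -!(lift_perm_lift i) e.
Qed.

Lemma SimsunP m (w : 'S_m) : reflect
  (forall j, (j <= m)%N -> ~~ has_double_descent [seq x <- one_line w | (x <= j)%N])
  (w \in Simsun m).
Proof.
rewrite inE; apply: (iffP forallP) => h j; last by apply: h; rewrite -ltnS.
by rewrite -ltnS => jm; exact: (h (Ordinal jm)).
Qed.

Lemma filter_one_line m (w : 'S_m) : [seq x <- one_line w | (x <= m)%N] = one_line w.
Proof. by apply/all_filterP/allP => _ /mapP[k _ ->]. Qed.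

Lemma Simsun_no_double_descent m (w : 'S_m) :
  w \in Simsun m -> ~~ has_double_descent (one_line w).
Proof. by move/SimsunP/(_ _ (leqnn m)); rewrite filter_one_line. Qed.

(** Restricting to letters at most [j <= m] erases the inserted letter, so only the condition on the
    whole word is new. *)
Lemma Simsun_lift m (i : 'I_m.+1) (s : 'S_m) :
  (lift_perm i ord_max s \in Simsun m.+1) =
  (s \in Simsun m) && ~~ descent_at (one_line s) i.
Proof.
have im : (i <= size (one_line s))%N by rewrite size_one_line -ltnS.
have flt j : (j <= m)%N ->
    [seq x <- one_line (lift_perm i ord_max s) | (x <= j)%N] =
    [seq x <- one_line s | (x <= j)%N].
  move=> jm; rewrite one_line_lift filter_cat /= leqNgt ltnS jm /=.
  by rewrite -filter_cat cat_take_drop.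
have hdd := has_double_descent_insert im (one_line_lt s).
apply/idP/andP => [/SimsunP h|[/[dup] sS /SimsunP h nd]].
  have sS : s \in Simsun m by apply/SimsunP => j jm; rewrite -flt // h // ltnW.
  split=> //; rewrite -hdd ?Simsun_no_double_descent // -one_line_lift.
  by rewrite -filter_one_line h.
apply/SimsunP => j; rewrite leq_eqVlt ltnS => /orP[/eqP->|jm]; last by rewrite flt // h.
by rewrite filter_one_line one_line_lift hdd // Simsun_no_double_descent.
Qed.

Lemma des_sum m (w : 'S_m) : des w = (\sum_(i < m) descent_at (one_line w) i)%N.
Proof.
by rewrite /des card_sum_nat; apply: eq_bigr => i _; rewrite /descent_at size_one_line.
Qed.

Lemma des_le m (w : 'S_m) : (des w <= m)%N.
Proof. by rewrite -[X in (_ <= X)%N](card_ord m) max_card. Qed.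

(** Insertion creates a descent at [i], unless at the end, and destroys one at [i - 1] if present.
    The loss is added on the left to avoid truncated subtraction. *)
Lemma des_lift m (i : 'I_m.+1) (s : 'S_m) :
  (des (lift_perm i ord_max s) + ((0 < i) && descent_at (one_line s) i.-1) =
   des s + (i < m))%N.
Proof.
have im : (i <= m)%N by rewrite -ltnS.
have im' : (i <= size (one_line s))%N by rewrite size_one_line.
rewrite !des_sum.
under eq_bigr do
  rewrite one_line_lift (descent_at_insert im' (one_line_lt s)) size_one_line.
move: (descent_at (one_line s)) => d.
rewrite (bigD1_ord i) //=.
have -> : (i.+1 < i)%N = false by lia.
have -> : (i.+1 == i :> nat) = false by lia.
rewrite eqxx -addnA [RHS]addnC; congr (_ + _)%N.
transitivity (\sum_(k < m) ((k.+1 != i :> nat) && d k) +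
              \sum_(k < m) ((k.+1 == i :> nat) && d k))%N.
  congr (_ + _)%N.
    apply: eq_bigr => k _; rewrite /bump; case: (leqP i k) => ik; rewrite ?add1n ?add0n.
      have -> : (k.+2 < i)%N = false by lia.
      have -> : (k.+2 == i :> nat) = false by lia.
      have -> : (k.+1 == i :> nat) = false by lia.
      by [].
    case: ltngtP => //= ki; lia.
  case: (posnP i) => [->|i0]; first by rewrite big1.
  have im1 : (i.-1 < m)%N by lia.
  rewrite (bigD1 (Ordinal im1)) //= prednK // eqxx big1 ?addn0 // => k.
  by rewrite -val_eqE /= => ki; case: eqP => // e; lia.
by rewrite -big_split; apply: eq_bigr => k _; case: eqP => _; case: (d k).
Qed.

(** * The recurrence of the simsun polynomial *)

Definition simsun_poly m : {poly int} := \sum_(w in Simsun m) 'X^(m - des w).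

Lemma simsun_poly0 : simsun_poly 0 = 1.
Proof.
rewrite /simsun_poly (eq_bigl predT) => [|w]; last first.
  apply/SimsunP => j _; apply/has_double_descentP => -[i].
  rewrite /descent_at => /andP[/andP[+ _] _].
  by rewrite ltnNge (leq_trans (size_subseq (filter_subseq _ _))) // size_one_line.
rewrite (eq_bigr (fun=> 1)) => [|w _]; last by rewrite sub0n expr0.
by rewrite sumr_const card_Sn.
Qed.

(* With k descents, the k + 1 insertions at the end or inside a descent keep k, *)
(* the k insertions before a descent top are forbidden, the other m - 2 k ones *)
(* create a descent.                                                           *)
Lemma sum_insert m (s : 'S_m) : s \in Simsun m ->
  \sum_(i < m.+1 | ~~ descent_at (one_line s) i)
    'X^(m.+1 - des (lift_perm i ord_max s)) =
  'X^(m.+1 - des s) *+ (des s).+1 + 'X^(m - des s) *+ m - 'X^(m - des s) *+ (2 * des s)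
  :> {poly int}.
Proof.
move=> sS; set k := des s; set d := descent_at (one_line s).
have kE : k = (\sum_(i < m) d i)%N by apply: des_sum.
have dm : d m = false by rewrite /d /descent_at size_one_line ltnNge leqnSn.
pose e i := (0 < i)%N && d i.-1.
have em : e m = false.
  rewrite /e; case: posnP => //= m0.
  by rewrite /d /descent_at size_one_line prednK // ltnn.
have de i : d i && e i = false.
  apply: contraNF (Simsun_no_double_descent sS) => /andP[di /andP[i0 di1]].
  by apply/has_double_descentP; exists i.-1; rewrite prednK //; apply/andP.
rewrite big_mkcond /=.
(* At most one of [d i], [e i] and [i = m] holds. The term is 0 if [d i], keeps [k] descents if
   [e i] or [i = m], and gains one otherwise; in this form the indicators are summed separately. *)
transitivity (\sum_(i < m.+1) ('X^(m.+1 - k) *+ (e i + (i == m :> nat)) +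
   'X^(m - k) - 'X^(m - k) *+ (d i + e i + (i == m :> nat))) : {poly int}).
  apply: eq_bigr => i _; have := des_lift i s; rewrite -/k -/d -/(e i).
  have [->|im] := eqVneq (i : nat) m.
    by rewrite dm em ltnn !addn0 => -> /=; ring.
  have -> : (i < m)%N by rewrite ltn_neqAle im -ltnS /=.
  have := de i; case: (d i); case: (e i) => //= _; rewrite ?addn0 ?addn1.
  - by move=> _; ring.
  - by move=> [->]; ring.
  - by move=> ->; rewrite subSS; ring.
have sd : (\sum_(i < m.+1) d i = k)%N by rewrite big_ord_recr /= dm addn0 kE.
have se : (\sum_(i < m.+1) e i = k)%N by rewrite big_ord_recl add0n kE.
have s1 : (\sum_(i < m.+1) (i == m :> nat) = 1)%N.
  rewrite big_ord_recr /= eqxx big1 // => i _.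
  by rewrite (ltn_eqF (ltn_ord i)).
rewrite sumrB big_split /= !sumrMnr !big_split /= sd se s1 sumr_const card_ord.
rewrite mul2n -addnn !addn1 -!addrA; congr (_ + _).
by rewrite !mulrSr; ring.
Qed.

Lemma simsun_polyS m : simsun_poly m.+1 =
  ('X * simsun_poly m) *+ m.+1 + ('X *+ 2 - 'X ^+ 2) * (simsun_poly m)^`()
  - simsun_poly m *+ m.
Proof.
rewrite /simsun_poly big_mkcond sum_lift_perm [in RHS]raddf_sum /=.
transitivity (\sum_(s in Simsun m) \sum_(i < m.+1 | ~~ descent_at (one_line s) i)
    'X^(m.+1 - des (lift_perm i ord_max s)) : {poly int}).
  rewrite [RHS]big_mkcond; apply: eq_bigr => s _; case: ifP => sS.
    by rewrite [RHS]big_mkcond; apply: eq_bigr => i _; rewrite Simsun_lift sS.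
  by apply: big1 => i _; rewrite Simsun_lift sS.
rewrite !mulr_sumr -!sumrMnl -big_split -sumrB /=; apply: eq_bigr => s sS.
rewrite sum_insert // derivXn subSn ?des_le // exprS.
have := des_le s; move: (des s) => k km.
(* In terms of the exponent [e = m - k], the multiplicities become linear in [e], which the
   derivative of ['X^e] supplies. *)
have -> : m = (m - k + k)%N by rewrite subnK.
rewrite addnK; move: (m - k)%N => e {km}.
case: e => [|e]; first by rewrite mulr0n expr0; ring.
by rewrite /= exprS; ring.
Qed.

(** * Comparison with the inversion polynomial *)

(** Without leaves [f] is onto, hence injective, so reachability is symmetric and the fixed point 0
    would reach every vertex. This makes the exponent [lev E - 1] an honest subtraction. *)
Lemma leaves_gt0 n (f : {ffun 'I_n.+1 -> 'I_n.+1}) :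
  (0 < n)%N -> parent_fun [set~ ord0] f -> (0 < leaves [set~ ord0] f)%N.
Proof.
move=> n0 /parent_funP[f_reach _ f0]; rewrite lt0n.
apply: contraTneq n0 => /cards0_eq/setP lf0.
have {}f0 : f ord0 = ord0 by rewrite f0 // setC11.
have f_inj : injective f.
  suff : #|codom f| == #|'I_n.+1| by move/image_injP => h x y; apply: h.
  apply/eqP/eq_card => v; rewrite inE; have := lf0 v; rewrite !inE.
  by have [->|_ /negbFE] := eqVneq v ord0; first by rewrite -f0 codom_f.
have := f_reach ord_max; rewrite (fconnect_sym f_inj) (fconnect_fixed _ f0).
by move/eqP/(congr1 val) => /= <-.
Qed.

Lemma inv_poly_tree_poly n : (0 < n)%N -> 'X * (inv_poly n).[-1] = tree_poly n.
Proof.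
move=> n0; rewrite /inv_poly.
have -> : Tree n = @tree_of n @: [set f | parent_fun [set~ ord0] f].
  apply/setP => E; apply/idP/imsetP => [/tree_of_surj[f fP ->]|[f + ->]].
    by exists f; rewrite ?inE.
  by rewrite inE; apply: tree_of_Tree.
rewrite big_imset => [|f g]; last by rewrite !inE; apply: tree_of_inj.
rewrite horner_sum mulr_sumr; apply: eq_big => [f|f]; first by rewrite inE.
rewrite inE => fP; rewrite hornerM hornerXn hornerC inv_tree_of // lev_tree_of //.
by rewrite mulrCA -exprS subn1 prednK // leaves_gt0.
Qed.

(** Multiplication by t turns the recurrence [simsun_polyS] into [tree_polyS], by the product
    rule. *)
Lemma tree_poly_simsun n : tree_poly n.+1 = 'X * simsun_poly n.
Proof.
elim: n => [|n IHn]; first by rewrite tree_poly1 simsun_poly0 mulr1.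
by rewrite tree_polyS // IHn simsun_polyS derivM derivX; ring.
Qed.

Theorem theorem3p6 (n : nat) (hn : (1 <= n)%N) :
  (inv_poly n).[-1] = \sum_(w in Simsun n.-1) 'X^(n - 1 - des w) :> {poly int}.
Proof.
apply: (@mulfI _ 'X); first by rewrite polyX_eq0.
rewrite inv_poly_tree_poly //; case: n hn => // n _.
by rewrite tree_poly_simsun subn1.
Qed.
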